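(* Let $d_1,\ldots,d_n$ be nonnegative integers, put $N = d_1 + \cdots + d_n$, and let $F$ be an algebraically closed field of characteristic $0$ or $p > N$. Let $B$ be the monomial complete intersection ring $$B = F[x_1,\ldots,x_n]/(x_1^{d_1+1},\ldots,x_n^{d_n+1}),$$ with its natural grading, and write $|B_i|$ for the dimension over $F$ of its homogeneous component $B_i$ of degree $i$. Let $l$ be a general element of $B$. Then the Weyr structure of the multiplication map $\times l : B \to B$ (associated with its sole eigenvalue) is given by the partition $|B| = |B_0| + |B_1| + \cdots + |B_N|$ of $|B| = \dim_F B$, once its terms are arranged in decreasing (i.e. non-increasing) order.
   Context: The natural grading on $B$ is induced by giving each variable degree $1$. For any $f \in B$, the endomorphism $\times f : B \to B$, $m \mapsto fm$, has a single eigenvalue, namely the constant term of $f$. A statement holds for a general element $l \in B$ if there is a nonempty Zariski-open subset $U$ of $B$ (regarded as an affine space over $F$) such that it holds for every $l \in U$. The Weyr structure of an endomorphism $T$ of a finite-dimensional vector space associated with an eigenvalue $\lambda$ is the sequence $(n_1,\ldots,n_r)$, where $r$ is the least positive integer with $\operatorname{rank}(T-\lambda I)^r = \operatorname{rank}(T-\lambda I)^{r+1}$ and $n_i = \operatorname{rank}(T-\lambda I)^{i-1} - \operatorname{rank}(T-\lambda I)^i$ for $i=1,\ldots,r$. It satisfies $n_1 \ge n_2 \ge \cdots \ge n_r \ge 1$. *)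

(* Defs.v *)
From HB Require Import structures.
From mathcomp Require Import all_boot all_order all_algebra all_field.
From mathcomp Require Import ring_quotient generic_quotient.
From mathcomp.multinomials Require Import mpoly.

Set Implicit Arguments.
Unset Strict Implicit.
Unset Printing Implicit Defensive.

Import GRing.Theory.
Local Open Scope ring_scope.
Local Open Scope quotient_scope.

Section Weyr.
Variables (F : fieldType) (V : vectType F).
Implicit Types (T : 'End(V)) (a : F).

Definition lfun_pow T (k : nat) : 'End(V) := iter k (comp_lfun T) \1%VF.

(* rank (T - a I)^k *)
Definition shift_rank T a (k : nat) : nat :=
  \dim (limg (lfun_pow (T - a *: \1%VF) k)).

Lemma shift_rankS T a k : (shift_rank T a k.+1 <= shift_rank T a k)%N.
Proof.
rewrite /shift_rank; set S := T - _; rewrite [lfun_pow S k.+1]/= limg_comp.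
by rewrite -[X in (_ <= X)%N](limg_ker_dim S) leq_addl.
Qed.

Fact weyr_index_exists T a :
  exists r, (0 < r)%N && (shift_rank T a r == shift_rank T a r.+1).
Proof.
set f := shift_rank T a.
have [/existsP[r Pr]|] :=
  boolP [exists r : 'I_(f 0%N).+2, (0 < r)%N && (f r == f r.+1)].
  by exists r.
rewrite negb_exists => /forallP nP.
have lt_f k : (k <= (f 0%N).+1)%N -> (f k.+1 + k <= f 0%N)%N.
  elim: k => [|k IHk] lek; first by rewrite addn0 shift_rankS.
  rewrite addnS (leq_trans _ (IHk (ltnW lek))) // ltn_add2r ltn_neqAle.
  rewrite shift_rankS andbT eq_sym.
  by have := nP (Ordinal (lek : (k.+1 < (f 0%N).+2)%N)).
by have := lt_f _ (leqnn _); rewrite addnS ltnNge leq_addl.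
Qed.

Definition weyr_index T a : nat := ex_minn (weyr_index_exists T a).

Definition weyr_structure T a : seq nat :=
  [seq (shift_rank T a i - shift_rank T a i.+1)%N | i <- iota 0 (weyr_index T a)].

(* V is identified with affine (dim V)-space by the coordinates v2r; the
   Zariski topology does not depend on the choice of linear coordinates. The
   family of polynomials S may be infinite. *)
Definition zariski_open (U : V -> Prop) : Prop :=
  exists S : {mpoly F[dim V]} -> Prop, forall v, U v <->
    exists2 p, S p & p.@[fun i => VectorInternalTheory.v2r v 0 i] != 0.

Definition for_general (P : V -> Prop) : Prop :=
  exists U : V -> Prop,
    [/\ zariski_open U, (exists v, U v) & forall v, U v -> P v].

End Weyr.

Section MonomialCompleteIntersection.
Variables (F : fieldType) (n : nat) (d : 'I_n -> nat).
Implicit Types (p q : {mpoly F[n]}) (m : 'X_{1..n}).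

(* The ideal (x_1^(d_1+1), ..., x_n^(d_n+1)), in decidable form: every monomial
   of p is divisible by some generator. mci_idealP shows that it is the ideal
   generated by these powers. *)
Definition mci_ideal : {pred {mpoly F[n]}} :=
  fun p => all (fun m => [exists i, (d i < m i)%N]) (msupp p).

Lemma mci_ideal_coefP p :
  reflect (forall m, (forall i, m i <= d i)%N -> p@_m = 0) (p \in mci_ideal).
Proof.
apply: (iffP allP) => [Ip m le_m | Ip m].
  apply/eqP; rewrite mcoeff_eq0; apply/negP => /Ip /existsP[i].
  by rewrite ltnNge le_m.
rewrite mcoeff_msupp; apply: contraNT; rewrite negb_exists => /forallP ltm.
by rewrite Ip // => i; rewrite leqNgt ltm.
Qed.

Fact mci_ideal_closed : idealr_closed mci_ideal.
Proof.
split.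
- by apply/mci_ideal_coefP => m _; rewrite mcoeff0.
- apply/negP => /mci_ideal_coefP /(_ 0%MM); rewrite mcoeff1 eqxx => nz1.
  have /eqP : true%:R = 0 :> F by apply: nz1 => i; rewrite mnm0E.
  by rewrite oner_eq0.
- move=> a u v /mci_ideal_coefP Iu /mci_ideal_coefP Iv.
  apply/mci_ideal_coefP => m lem; rewrite mcoeffD Iv // addr0 mcoeffM.
  rewrite big1 // => -[k1 k2] /= /eqP def_m; rewrite Iu ?mulr0 // => i.
  by apply: leq_trans (lem i); move/mnmP: def_m => ->; rewrite mnmDE leq_addl.
Qed.

HB.instance Definition _ := isIdealr.Build {mpoly F[n]} mci_ideal mci_ideal_closed.

Lemma mci_idealP p :
  reflect (exists g : 'I_n -> {mpoly F[n]}, p = \sum_i g i * 'X_i ^+ (d i).+1)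
          (p \in mci_ideal).
Proof.
apply: (iffP idP) => [/allP Ip | [g ->]].
  rewrite [p]mpolyE; elim: (msupp p) Ip => [|m s IHs] Ip.
    exists (fun=> 0); rewrite big_nil big1 // => i _; exact: mul0r.
  have [|g def_g] := IHs; first by move=> k sk; rewrite Ip // inE sk orbT.
  have /existsP[i lt_i] := Ip m (mem_head _ _).
  exists (fun j => g j + (if j == i then p@_m *: 'X_[m - U_(i) *+ (d i).+1] else 0)).
  rewrite big_cons def_g addrC.
  under [RHS]eq_bigr do rewrite mulrDl.
  rewrite big_split /=; congr (_ + _).
  rewrite (bigD1 i) //= eqxx big1 ?addr0; last first.
    by move=> j /negPf ->; rewrite mul0r.
  rewrite -scalerAl mpolyXn -mpolyXD submK //; apply/mnm_lepP => j.
  by rewrite mulmnE mnm1E; case: eqP => [<-|]; rewrite ?mul1n ?mul0n.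
rewrite -[_ \in _]/(_ \in (mci_ideal : idealr _)).
apply: rpred_sum => i _; apply: (idealMr (idealrI := mci_ideal)).
apply/mci_ideal_coefP => m lem; rewrite mcoeffXn.
case: eqP => // /(congr1 (fun k : 'X_{1..n} => k i)) def_m.
by have := lem i; rewrite -def_m mulmnE mnm1E eqxx mul1n ltnn.
Qed.

Definition mci : Type := {ideal_quot mci_ideal}.

HB.instance Definition _ := GRing.ComNzRing.on mci.

Definition mci_pi p : mci := \pi_{ideal_quot mci_ideal} p.
Definition mci_repr (b : mci) : {mpoly F[n]} :=
  @repr _ {ideal_quot mci_ideal} b.

Lemma mci_piP p q : reflect (mci_pi p = mci_pi q) (p - q \in mci_ideal).
Proof.
rewrite -[_ \in _]/(_ \in (mci_ideal : idealr _)) Quotient.idealrBE; exact: eqP.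
Qed.

Lemma mci_reprK : cancel mci_repr mci_pi.
Proof. exact: (@reprK _ {ideal_quot mci_ideal}). Qed.

Fact mci_pi_zmod_morphism : zmod_morphism mci_pi.
Proof. exact: (rmorphB (\pi_{ideal_quot mci_ideal})). Qed.
HB.instance Definition _ :=
  GRing.isZmodMorphism.Build {mpoly F[n]} mci mci_pi mci_pi_zmod_morphism.

Fact mci_pi_monoid_morphism : monoid_morphism mci_pi.
Proof.
split; first exact: (rmorph1 (\pi_{ideal_quot mci_ideal})).
exact: (rmorphM (\pi_{ideal_quot mci_ideal})).
Qed.
HB.instance Definition _ :=
  GRing.isMonoidMorphism.Build {mpoly F[n]} mci mci_pi mci_pi_monoid_morphism.

(* F acts through F -> F[x_1, ..., x_n] -> B. *)
Definition mci_scale (c : F) (b : mci) : mci := mci_pi c%:MP * b.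

Fact mci_scaleA a b v : mci_scale a (mci_scale b v) = mci_scale (a * b) v.
Proof. by rewrite /mci_scale mulrA -rmorphM /= -mpolyCM. Qed.

Fact mci_scale1 : left_id 1 mci_scale.
Proof. by move=> v; rewrite /mci_scale rmorph1 mul1r. Qed.

Fact mci_scaleDr : right_distributive mci_scale +%R.
Proof. by move=> c u v; rewrite /mci_scale mulrDr. Qed.

Fact mci_scaleDl v : {morph mci_scale^~ v : a b / a + b}.
Proof. by move=> a b; rewrite /mci_scale mpolyCD rmorphD mulrDl. Qed.

HB.instance Definition _ := GRing.Zmodule_isLmodule.Build F mci
  mci_scaleA mci_scale1 mci_scaleDr mci_scaleDl.

Fact mci_scaleAl (c : F) (u v : mci) : c *: (u * v) = (c *: u) * v.
Proof. exact: mulrA. Qed.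
HB.instance Definition _ := GRing.Lmodule_isLalgebra.Build F mci mci_scaleAl.
HB.instance Definition _ := GRing.Lalgebra_isComAlgebra.Build F mci.

Fact mci_pi_scalable : scalable mci_pi.
Proof. by move=> c p; rewrite -mul_mpolyC rmorphM. Qed.
HB.instance Definition _ :=
  GRing.isScalable.Build F {mpoly F[n]} mci *:%R mci_pi mci_pi_scalable.

(* The monomials x_1^m_1 ... x_n^m_n with m_i <= d_i give a basis of B. *)
Definition mci_index := {dffun forall i : 'I_n, 'I_(d i).+1}.
Definition mci_mnm (t : mci_index) : 'X_{1..n} := [multinom (t i : nat) | i < n].

Lemma mci_mnm_inj : injective mci_mnm.
Proof.
move=> t u /mnmP eq_tu; apply/ffunP => i; apply: val_inj.
by have := eq_tu i; rewrite !mnmE.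
Qed.

Lemma mci_mnm_surj m : (forall i, m i <= d i)%N -> exists t, m = mci_mnm t.
Proof.
move=> lem; exists [ffun i => Ordinal (lem i : (m i < (d i).+1)%N)].
by apply/mnmP => i; rewrite mnmE ffunE.
Qed.

Lemma mci_mnm_le t i : (mci_mnm t i <= d i)%N.
Proof. by rewrite mnmE -ltnS. Qed.

Lemma mci_repr_pi p m : (forall i, m i <= d i)%N -> (mci_repr (mci_pi p))@_m = p@_m.
Proof.
move=> lem; apply/eqP; rewrite -subr_eq0 -mcoeffB; apply/eqP.
by apply: mci_ideal_coefP m lem; apply/mci_piP; rewrite mci_reprK.
Qed.

Definition mci_coords (b : mci) : 'rV[F]_#|{: mci_index}| :=
  \row_k (mci_repr b)@_(mci_mnm (enum_val k)).

Definition mci_of_coords (r : 'rV[F]_#|{: mci_index}|) : mci :=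
  mci_pi (\sum_k r 0 k *: 'X_[mci_mnm (enum_val k)]).

Fact mci_vector : Vector.axiom #|{: mci_index}| mci.
Proof.
have piE p k : mci_coords (mci_pi p) 0 k = p@_(mci_mnm (enum_val k)).
  by rewrite mxE mci_repr_pi //; exact: mci_mnm_le.
exists mci_coords.
  move=> c u v; rewrite -[u]mci_reprK -[v]mci_reprK -linearP.
  apply/rowP => k; rewrite piE [RHS]mxE [X in _ = X + _]mxE !piE.
  by rewrite mcoeffD mcoeffZ.
exists mci_of_coords => [b|r].
  rewrite -[RHS]mci_reprK; apply/mci_piP/mci_ideal_coefP => m lem.
  have [t ->] := mci_mnm_surj lem.
  rewrite mcoeffB raddf_sum /= (bigD1 (enum_rank t)) //= big1.
    by rewrite mcoeffZ mcoeffX mxE enum_rankK eqxx mulr1 addr0 subrr.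
  move=> k nkt; rewrite mcoeffZ mcoeffX (inj_eq mci_mnm_inj).
  by rewrite (can2_eq enum_valK enum_rankK) (negPf nkt) mulr0.
apply/rowP => k; rewrite piE raddf_sum /= (bigD1 k) //= big1.
  by rewrite mcoeffZ mcoeffX eqxx mulr1 addr0.
move=> j njk; rewrite mcoeffZ mcoeffX (inj_eq mci_mnm_inj).
by rewrite (inj_eq enum_val_inj) (negPf njk) mulr0.
Qed.
HB.instance Definition _ := Lmodule_hasFinDim.Build F mci mci_vector.
HB.instance Definition _ := Algebra_isFalgebra.Build F mci.

Definition mci_const (b : mci) : F := (mci_repr b)@_0.

Lemma mci_const_pi p : mci_const (mci_pi p) = p@_0.
Proof. by apply: mci_repr_pi => i; rewrite mnm0E. Qed.

Fact mcoeff_expr_eq0 p k m : p@_0 = 0 -> (mdeg m < k)%N -> (p ^+ k)@_m = 0.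
Proof.
move=> p0; elim: k m => // k IHk m; rewrite ltnS => lemk.
rewrite exprS mcoeffM big1 // => -[k1 k2] /= /eqP def_m.
have [k1_0 | nz_k1] := eqVneq (bmnm k1) 0%MM; first by rewrite k1_0 p0 mul0r.
rewrite IHk ?mulr0 //; apply: leq_trans lemk.
have := congr1 (@mdeg n) def_m; rewrite mdegD => deg_m.
apply: (@leq_trans (mdeg k1 + mdeg k2)); last exact: eq_leq.
by rewrite -[X in (X < _)%N]add0n ltn_add2r lt0n mdeg_eq0.
Qed.

Lemma mci_nilpotent b : mci_const b = 0 -> b ^+ (\sum_i d i).+1 = 0.
Proof.
move=> b0; rewrite -[b]mci_reprK -rmorphXn -[RHS](rmorph0 mci_pi).
apply/mci_piP; rewrite subr0; apply/mci_ideal_coefP => m lem.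
by rewrite mcoeff_expr_eq0 // ltnS mdegE leq_sum.
Qed.

Lemma mci_sole_eigenvalue b a : passmx.leigenvalue (amull b) a = (a == mci_const b).
Proof.
set c := mci_const b; set u := b - c *: 1.
have u_nil : u ^+ (\sum_i d i).+1 = 0.
  apply: mci_nilpotent; rewrite /u /c -{1}[b]mci_reprK -(rmorph1 mci_pi).
  rewrite -linearZ -raddfB mci_const_pi mcoeffB mcoeffZ mcoeff1 eqxx mulr1.
  exact: subrr.
have in_eig x v : (v \in passmx.leigenspace (amull b) x) = (b * v == x *: v).
  by rewrite memv_ker !lfun_simp subr_eq0.
rewrite /passmx.leigenvalue; apply/idP/eqP => [|->].
  rewrite -vpick0; set v := vpick _ => nz_v.
  have /eqP def_bv : b * v == a *: v by rewrite -in_eig memv_pick.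
  have uv k : u ^+ k * v = (a - c) ^+ k *: v.
    elim: k => [|k IHk]; first by rewrite mul1r scale1r.
    rewrite exprSr -mulrA mulrBl def_bv -scalerAl mul1r -scalerBl -scalerAr IHk.
    by rewrite scalerA -exprS.
  have /eqP := uv (\sum_i d i).+1.
  rewrite u_nil mul0r eq_sym scaler_eq0 (negPf nz_v) orbF expf_eq0 /=.
  by rewrite subr_eq0 => /eqP.
apply/eqP => eig0; move: u_nil; elim: _.+1 => [|k IHk] uk0.
  by move/eqP: uk0; rewrite oner_eq0.
apply: IHk; apply/eqP; rewrite -memv0 -eig0 in_eig -subr_eq0.
by rewrite -[X in _ - _ *: X]mul1r scalerAl -mulrBl -exprS uk0.
Qed.

(* The natural grading: the component of degree i is the image of the forms of
   degree i, as mem_mci_homog shows. *)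
Definition mci_homog (i : nat) : {vspace mci} :=
  <<[seq mci_pi 'X_[m] | m : 'X_{1..n < i.+1} in [pred m | mdeg (bmnm m) == i]]>>%VS.

Lemma mem_mci_homog i b :
  b \in mci_homog i <-> exists2 p, p \is i.-homog & b = mci_pi p.
Proof.
split=> [|[p /dhomogP homp ->]].
  rewrite /mci_homog; set X := image _ _ => /(@coord_span _ _ _ (in_tuple X)) ->.
  elim/big_ind: _ => [|_ _ [p hp ->] [q hq ->]|k _].
  - by exists 0; rewrite ?rpred0 ?raddf0.
  - by exists (p + q); rewrite ?rpredD ?raddfD.
  - have /imageP[m] : X`_k \in X by rewrite mem_nth.
    rewrite inE => degm ->; exists (coord (in_tuple X) k b *: 'X_[bmnm m]).
      by rewrite rpredZ // dhomogX.
    by rewrite linearZ.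
rewrite [p]mpolyE raddf_sum /= big_seq rpred_sum // => m /homp degm.
rewrite linearZ rpredZ //; apply: memv_span; apply/imageP.
have ltm : (mdeg m < i.+1)%N by rewrite degm.
by exists (BMultinom ltm); rewrite ?inE //= degm.
Qed.

End MonomialCompleteIntersection.

Arguments mci_pi {F n d} p.
Arguments mci_const {F n d} b.

(* Main.v *)
From HB Require Import structures.
Require Import Defs.
From mathcomp Require Import all_boot all_order all_algebra all_field.
From mathcomp.multinomials Require Import mpoly.
From mathcomp Require Import zify ring.

Set Implicit Arguments.
Unset Strict Implicit.
Unset Printing Implicit Defensive.

Import VectorInternalTheory GRing.Theory.
Local Open Scope ring_scope.

(* Write s for the class of x_1 + ... + x_n and h_i = |B_i|; then h_i = h_(N-i).
   Multiplication by s is the raising operator of an sl_2-action on B, and the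
   commutation rule with the lowering operator shows that s^k is injective on
   B_e as soon as 2e + k <= N; the integers that have to be inverted are at most
   N, whence the hypothesis on the characteristic. By symmetry s^k maps B_e
   onto B_(e+k) when N <= 2e + k, and h is unimodal.
   Let a = floor((N+1-k)/2). If f has no term of degree < k, then splitting B
   into degrees < a and >= a gives
     rank f <= sum_(e < a) h_e + sum_(e >= a+k) h_e,
   with equality for f = s^k. Lower semicontinuity of the rank gives the same
   ranks for (l - c)^k, with l general and c its constant term. Consecutive
   ranks differ by h_(floor((N-k)/2)), which lists the h_i in non-increasing
   order, from the central degrees outwards. *)

(** * Semicontinuity of the rank *)

Section PolynomialFunctions.
Variables (F : fieldType) (V : vectType F).
Implicit Types (f g : V -> F).

(** The coordinates are those of [zariski_open], so nonvanishing is an open condition. The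
    existential form lets polynomiality be proved by closure properties alone. *)
Definition polyfun f :=
  exists p : {mpoly F[dim V]}, forall v, f v = p.@[fun i => v2r v 0 i].

Lemma eq_polyfun f g : f =1 g -> polyfun f -> polyfun g.
Proof. by move=> e [p fp]; exists p => v; rewrite -e. Qed.

Lemma polyfun_const c : polyfun (fun=> c).
Proof. by exists c%:MP => v; rewrite mevalC. Qed.

Lemma polyfun_coord i : polyfun (fun v => v2r v 0 i).
Proof. by exists 'X_i => v; rewrite mevalXU. Qed.

Lemma polyfunD f g : polyfun f -> polyfun g -> polyfun (fun v => f v + g v).
Proof. by move=> [p fp] [q gq]; exists (p + q) => v; rewrite mevalD fp gq. Qed.

Lemma polyfunM f g : polyfun f -> polyfun g -> polyfun (fun v => f v * g v).
Proof. by move=> [p fp] [q gq]; exists (p * q) => v; rewrite mevalM fp gq. Qed.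

Lemma polyfun_sum (I : Type) (r : seq I) (f : I -> V -> F) :
  (forall i, polyfun (f i)) -> polyfun (fun v => \sum_(i <- r) f i v).
Proof.
move=> pf; elim: r => [|i r IHr].
  by apply: eq_polyfun (polyfun_const 0) => v; rewrite big_nil.
by apply: eq_polyfun (polyfunD (pf i) IHr) => v; rewrite big_cons.
Qed.

Lemma polyfun_prod (I : Type) (r : seq I) (f : I -> V -> F) :
  (forall i, polyfun (f i)) -> polyfun (fun v => \prod_(i <- r) f i v).
Proof.
move=> pf; elim: r => [|i r IHr].
  by apply: eq_polyfun (polyfun_const 1) => v; rewrite big_nil.
by apply: eq_polyfun (polyfunM (pf i) IHr) => v; rewrite big_cons.
Qed.

Definition polyfun_mx m k (A : V -> 'M[F]_(m, k)) :=
  forall i j, polyfun (fun v => A v i j).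

Lemma polyfun_mulmx m k l (A : V -> 'M[F]_(m, k)) (B : V -> 'M[F]_(k, l)) :
  polyfun_mx A -> polyfun_mx B -> polyfun_mx (fun v => A v *m B v).
Proof.
move=> pA pB i j; apply: (@eq_polyfun (fun v => \sum_k A v i k * B v k j)).
  by move=> v; rewrite mxE.
by apply: polyfun_sum => l'; apply: polyfunM.
Qed.

Lemma polyfun_det m (A : V -> 'M[F]_m) :
  polyfun_mx A -> polyfun (fun v => \det (A v)).
Proof.
move=> pA; rewrite /determinant; apply: polyfun_sum => s.
by apply: polyfunM; [apply: polyfun_const | apply: polyfun_prod].
Qed.

Lemma zariski_open_polyfun f : polyfun f -> zariski_open (fun v => f v != 0).
Proof.
move=> [p fp]; exists (fun q => q = p) => v.
by rewrite fp; split=> [|[q ->]//]; exists p.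
Qed.

End PolynomialFunctions.

Lemma dim_limg_f2mx (F : fieldType) (V W : vectType F) (T : 'Hom(V, W)) :
  \dim (limg T) = \rank (f2mx T).
Proof.
rewrite unlock /dimv mx2vsK eqmxMfull //.
by rewrite /row_full mx2vsK mxrank1.
Qed.

(** [P] writes a row base of [A] in terms of its rows and [Q] is a right inverse of that base, so
    the product is the identity. For fixed [P] and [Q] this determinant is polynomial in [A]; it
    plays the role of a maximal nonzero minor. *)
Lemma rank_witness (F : fieldType) m k (A : 'M[F]_(m, k)) :
  exists P : 'M_(\rank A, m), exists Q : 'M_(k, \rank A),
    \det (P *m A *m Q) != 0.
Proof.
have /submxP[P defP] : (row_base A <= A)%MS by rewrite eq_row_base.
have /row_freeP[Q QK] := row_base_free A.
by exists P, Q; rewrite -defP QK det1 oner_eq0.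
Qed.

Lemma rank_ge_det (F : fieldType) m k r (A : 'M[F]_(m, k)) (P : 'M_(r, m))
    (Q : 'M_(k, r)) :
  \det (P *m A *m Q) != 0 -> (r <= \rank A)%N.
Proof.
rewrite -unitfE -[_ \is a _]/(P *m A *m Q \in unitmx) => /mxrank_unit def_r.
rewrite -[X in (X <= _)%N]def_r.
exact: leq_trans (mxrankM_maxl _ _) (mxrankM_maxr _ _).
Qed.

(** The open set is where the product over [k] of the witness determinants taken at [v0] does not
    vanish; finiteness of the family makes this a single polynomial. *)
Lemma zariski_open_rank (F : fieldType) (V W : vectType F) K
    (T : 'I_K -> V -> 'End(W)) (v0 : V) :
  (forall k, polyfun_mx (fun v => f2mx (T k v))) ->
  exists U : V -> Prop, [/\ zariski_open U, U v0 &
    forall v, U v -> forall k, (\dim (limg (T k v0)) <= \dim (limg (T k v)))%N].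
Proof.
move=> pT.
have /fin_all_exists[P detP] := fun k => rank_witness (f2mx (T k v0)).
have {detP}/fin_all_exists[Q detPQ] := detP.
pose f v := \prod_k \det (P k *m f2mx (T k v) *m Q k).
exists (fun v => f v != 0); split.
- apply: zariski_open_polyfun; apply: polyfun_prod => k; apply: polyfun_det.
  apply: polyfun_mulmx; last by move=> i j; apply: polyfun_const.
  by apply: polyfun_mulmx => // i j; apply: polyfun_const.
- by apply/prodf_neq0 => k _.
- move=> v /prodf_neq0 nz k; rewrite !dim_limg_f2mx.
  exact: rank_ge_det (nz k isT).
Qed.

(** The factor [u] is arbitrary so that induction can absorb the last [w v]: expanding [v] in a
    basis [e j] replaces [u] by [w (e j) * u]. *)
Lemma polyfun_power (F : fieldType) (A : falgType F) (w : {linear A -> A}) k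
    (u : A) i :
  polyfun (fun v => v2r (w v ^+ k * u) 0 i).
Proof.
elim: k u => [|k IHk] u.
  by apply: eq_polyfun (polyfun_const _ (v2r u 0 i)) => v; rewrite mul1r.
pose e j : A := r2v (delta_mx 0 j).
apply: (@eq_polyfun _ _
  (fun v => \sum_j v2r v 0 j * v2r (w v ^+ k * (w (e j) * u)) 0 i)).
  move=> v; rewrite exprSr -mulrA.
  have def_v : v = \sum_j v2r v 0 j *: e j.
    rewrite -{1}[v]v2rK {1}[v2r v]row_sum_delta linear_sum.
    by apply: eq_bigr => j _; rewrite linearZ.
  rewrite [w v * u in RHS](congr1 (fun x => w x * u) def_v).
  rewrite linear_sum mulr_suml mulr_sumr linear_sum summxE.
  apply: eq_bigr => j _.
  by rewrite linearZ /= -scalerAl -scalerAr linearZ [RHS]mxE.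
by apply: polyfun_sum => j; apply: polyfunM; [apply: polyfun_coord|].
Qed.

Lemma polyfun_mx_power (F : fieldType) (A : falgType F) (w : {linear A -> A})
    k :
  polyfun_mx (fun v => f2mx (amull (w v ^+ k))).
Proof.
move=> i j; apply: eq_polyfun (polyfun_power w k (r2v (delta_mx 0 i)) j) => v.
have -> : w v ^+ k * r2v (delta_mx 0 i) = amull (w v ^+ k) (r2v (delta_mx 0 i)).
  by rewrite lfunE.
by rewrite unlock /fun_of_lfun_def /= !r2vK -rowE mxE.
Qed.

(** * Euler's identity and the linear form x_1 + ... + x_n *)

Lemma mcoeff_euler (R : comNzRingType) n (p : {mpoly R[n]}) i m :
  ('X_i * p^`M(i))@_m = p@_m *+ m i.
Proof.
have [m0|m_gt0] := posnP (m i).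
  rewrite m0 mulr0n mcoeffM big1 // => -[k1 k2] /= /eqP def_m.
  rewrite mcoeffX; case: eqP => [def_k|_]; last by rewrite mul0r.
  by move/mnmP/(_ i): def_m; rewrite m0 -def_k mnmDE mnm1E eqxx.
have def_m : m = (U_(i) + (m - U_(i)))%MM.
  rewrite addmC submK //; apply/mnm_lepP => j; rewrite mnm1E.
  by case: eqP => [<-|].
rewrite mulrC {1}def_m mcoeffMX mcoeff_deriv addmC -def_m.
by rewrite mnmBE mnm1E eqxx subn1 prednK.
Qed.

Lemma sum_euler (R : comNzRingType) n (p : {mpoly R[n]}) e :
  p \is e.-homog -> \sum_(i < n) 'X_i * p^`M(i) = p *+ e.
Proof.
move=> homp; apply/mpolyP => m; rewrite raddf_sum /= mcoeffMn.
under eq_bigr do rewrite mcoeff_euler.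
rewrite sumrMnr -mdegE; have [->//|ne] := eqVneq (mdeg m) e.
by rewrite (dhomog_nemf_coeff homp) ?mul0rn.
Qed.

Definition mpoly_sumX {F : fieldType} {n} : {mpoly F[n]} := \sum_(i < n) 'X_i.

Lemma dhomog_mpoly_sumX (F : fieldType) n :
  (@mpoly_sumX F n) \is 1.-homog.
Proof. by apply: rpred_sum => i _; rewrite dhomogX /= mdeg1. Qed.

Lemma mderiv_mpoly_sumX (F : fieldType) n i : (@mpoly_sumX F n)^`M(i) = 1.
Proof.
rewrite /mpoly_sumX raddf_sum (bigD1 i) //= big1 => [|j nji].
  rewrite mderivX mnm1E eqxx scale1r addr0.
  have -> : (U_(i) - U_(i))%MM = 0%MM :> 'X_{1..n}.
    by apply/mnmP => j; rewrite mnmBE subnn mnm0E.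
  exact: mpolyX0.
by rewrite mderivX mnm1E (negPf nji) scale0r.
Qed.

(** * The lowering operator *)

Section Lowering.
Variables (F : fieldType) (n : nat) (d : 'I_n -> nat).
Implicit Types (p q : {mpoly F[n]}) (m : 'X_{1..n}).
Let N := (\sum_(i < n) d i)%N.

(* The lowering operator of sl_2 on the tensor product over i of the
   representations with basis 1, x_i, ..., x_i^(d_i). *)
Definition lowering p : {mpoly F[n]} :=
  \sum_(i < n) ((d i)%:R *: p^`M(i) - 'X_i * p^`M(i)^`M(i)).

Lemma mcoeff_lowering p m :
  (lowering p)@_m =
  \sum_i p@_(m + U_(i)) * (m i).+1%:R * ((d i)%:R - (m i)%:R).
Proof.
rewrite raddf_sum /=; apply: eq_bigr => i _.
rewrite mcoeffB mcoeffZ mcoeff_euler mcoeff_deriv.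
by rewrite mulrBr !mulr_natr [X in X - _ = _]mulrC !mulr_natr.
Qed.

(** If raising the i-th exponent of [m] leaves the box m <= d, then m_i = d_i and the factor d_i -
    m_i of the coefficient vanishes. *)
Lemma lowering_ideal p : p \in mci_ideal d -> lowering p \in mci_ideal d.
Proof.
move/mci_ideal_coefP => Ip; apply/mci_ideal_coefP => m lem.
rewrite mcoeff_lowering big1 // => i _.
have [->|lt_m] := eqVneq (m i) (d i); first by rewrite subrr mulr0.
rewrite Ip ?mul0r // => j; rewrite mnmDE mnm1E.
have [<-|_] := eqVneq i j; last by rewrite addn0.
by rewrite addn1 ltn_neqAle lt_m lem.
Qed.

Lemma lowering_homog p e : p \is e.-homog -> lowering p \is e.-1.-homog.
Proof.
move=> homp; apply/dhomogP => m; rewrite mcoeff_msupp; apply: contraNeq => ne.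
rewrite mcoeff_lowering big1 // => i _.
rewrite (dhomog_nemf_coeff homp) ?mul0r //.
by apply: contra ne => /eqP <-; rewrite /= mdegD mdeg1 addn1.
Qed.

Lemma lowering_homog0 p : p \is 0.-homog -> lowering p = 0.
Proof.
move=> homp; apply/mpolyP => m; rewrite mcoeff0.
rewrite mcoeff_lowering big1 // => i _.
rewrite (dhomog_nemf_coeff homp) ?mul0r //.
by rewrite /= mdegD mdeg1 addn1.
Qed.

(* The sl_2 relation [lowering, raising] = N - 2 deg. *)
Lemma loweringM p e : p \is e.-homog ->
  lowering (mpoly_sumX * p) = mpoly_sumX * lowering p + (N%:R - e.*2%:R) *: p.
Proof.
move=> homp; rewrite /lowering mulr_sumr.
have -> : (N%:R - e.*2%:R) *: p =
    \sum_(i < n) ((d i)%:R *: p - 'X_i * p^`M(i) *+ 2).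
  rewrite sumrB -scaler_suml -natr_sum sumrMnl (sum_euler homp) -mulrnA muln2.
  by rewrite scalerBl -[p *+ _]scaler_nat.
rewrite -big_split /=; apply: eq_bigr => i _.
rewrite !mderivM !mderivD mderiv_mpoly_sumX !mderivM mderiv_mpoly_sumX.
by rewrite -!mul_mpolyC !mderivC; ring.
Qed.

(** The scalar is the sum of the weights N - 2(e + j) for j = 0, ..., k, one for each factor that
    [lowering] passes. *)
Lemma loweringXM p e k : p \is e.-homog ->
  lowering (mpoly_sumX ^+ k.+1 * p) = mpoly_sumX ^+ k.+1 * lowering p +
    (k.+1%:R * (N%:R - (e.*2 + k)%:R)) *: (mpoly_sumX ^+ k * p).
Proof.
elim: k p e => [|k IHk] p e homp.
  by rewrite expr1 expr0 mul1r addn0 mul1r (loweringM homp).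
have homp' : mpoly_sumX * p \is (e.+1).-homog.
  exact: (dhomogM (dhomog_mpoly_sumX F n) homp).
rewrite exprSr -mulrA (IHk _ _ homp') (loweringM homp).
rewrite mulrDr -scalerAr !mulrA -!exprSr -addrA -scalerDl.
congr (_ + _ *: _).
rewrite doubleS !addSn -!natr1 !natrD -!natr1; ring.
Qed.

Hypothesis charF : forall p : nat, p \in [pchar F] -> (N < p)%N.

Lemma natr_le_neq0 k : (0 < k <= N)%N -> k%:R != 0 :> F.
Proof.
case/andP=> k_gt0 leN; apply/negP => k0.
have [p chp] := natf0_pchar k_gt0 k0.
have := dvdn_leq k_gt0 (etrans (dvdn_pcharf chp k) k0).
by rewrite leqNgt (leq_ltn_trans leN (charF chp)).
Qed.

Lemma mci_pi_eq0 p : (mci_pi p == 0 :> mci F d) = (p \in mci_ideal d).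
Proof.
apply/eqP/idP => [pi0|Ip]; last first.
  by rewrite -(rmorph0 mci_pi); apply/mci_piP; rewrite subr0.
by rewrite -[p]subr0; apply/mci_piP; rewrite pi0 rmorph0.
Qed.

(* Applying [lowering] to s^(k+1) p turns it into s^(k+1) (lowering p) plus a
   nonzero multiple of s^k p. *)
Lemma raising_inj_step p e :
  p \is e.-homog ->
  (forall k, (e.*2 + k.+1 <= N)%N ->
     mpoly_sumX ^+ k.+2 * lowering p \in mci_ideal d ->
     lowering p \in mci_ideal d) ->
  forall k, (e.*2 + k <= N)%N ->
  mpoly_sumX ^+ k * p \in mci_ideal d -> p \in mci_ideal d.
Proof.
move=> homp ID; elim=> [|k IHk] le_N Ip; first by rewrite mul1r in Ip.
apply: IHk; first by apply: leq_trans le_N; rewrite leq_add2l.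
have := lowering_ideal Ip; have := ID _ le_N; move: Ip.
rewrite (loweringXM _ homp) -!mci_pi_eq0 !rmorphM /= !rmorphXn /= !rmorphD /=.
rewrite !linearZ /= !rmorphM /= !rmorphXn /=.
set s := mci_pi mpoly_sumX; set u := mci_pi (lowering p).
set c := (X in X *: _) => /eqP sp0 uP /eqP Dsp0.
(* Multiplying the relation by s kills its term in p, leaving s^(k+2) u = 0. *)
have /eqP u0 : u == 0.
  apply: uP; move/(congr1 ( *%R s)): Dsp0.
  by rewrite mulr0 mulrDr -scalerAr !mulrA -!exprS sp0 scaler0 addr0 => ->.
move/eqP: Dsp0; rewrite u0 mulr0 add0r scaler_eq0.
case/orP; last by apply.
(* Both k + 1 and N - 2e - k are integers between 1 and N, hence nonzero in F. *)
rewrite /c -natrD -natrB; last by lia.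
by rewrite mulf_eq0 !(negPf (natr_le_neq0 _)) //; lia.
Qed.

(** Induction on the degree: [lowering p] has degree e - 1, and 2(e - 1) + (k + 2) = 2e + k keeps
    the bound. In degree 0 it is zero. *)
Lemma raising_inj p e k :
  p \is e.-homog -> (e.*2 + k <= N)%N ->
  mpoly_sumX ^+ k * p \in mci_ideal d -> p \in mci_ideal d.
Proof.
elim: e p k => [|e IHe] p k homp; apply: (raising_inj_step homp).
  by move=> *; rewrite -mci_pi_eq0 lowering_homog0 ?rmorph0.
move=> l le_N; apply: IHe; first exact: (lowering_homog homp).
by lia.
Qed.

End Lowering.

(** * Monomial subspaces *)

Section DegreeSubspaces.
Variables (F : fieldType) (n : nat) (d : 'I_n -> nat).
Implicit Types (p q : {mpoly F[n]}) (m : 'X_{1..n}) (P Q : pred nat).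
Implicit Types (t : mci_index d) (b : mci F d).
Let N := (\sum_(i < n) d i)%N.

Definition mci_mon t : mci F d := mci_pi 'X_[mci_mnm t].
Definition mci_deg t : nat := mdeg (mci_mnm t).
(** Predicates treat graded components, truncations and outer degrees alike; for [pred1 i] the count
    is h_i. *)
Definition count_deg P : nat := #|[pred t | P (mci_deg t)]|.

Definition degspace P : {vspace mci F d} :=
  <<[seq mci_mon t | t in [pred t | P (mci_deg t)]]>>%VS.

Lemma mdeg_le m : (forall i, m i <= d i)%N -> (mdeg m <= N)%N.
Proof. by move=> lem; rewrite mdegE leq_sum. Qed.

Lemma mci_deg_le t : (mci_deg t <= N)%N.
Proof. by apply: mdeg_le => i; apply: mci_mnm_le. Qed.

Lemma mci_pi_expand p : mci_pi p = \sum_t p@_(mci_mnm t) *: mci_mon t.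
Proof.
rewrite /mci_mon; under eq_bigr do rewrite -linearZ.
rewrite -raddf_sum; apply/mci_piP/mci_ideal_coefP => m lem.
have [t ->] := mci_mnm_surj lem.
rewrite mcoeffB raddf_sum /= (bigD1 t) //= big1 ?addr0.
  by rewrite mcoeffZ mcoeffX eqxx mulr1 subrr.
move=> u nut; rewrite mcoeffZ mcoeffX (inj_eq (@mci_mnm_inj _ _)).
by rewrite (negPf nut) mulr0.
Qed.

Lemma mci_pi_coef p q m :
  mci_pi p = mci_pi q :> mci F d -> (forall i, m i <= d i)%N -> p@_m = q@_m.
Proof. by move=> e lem; rewrite -(mci_repr_pi p lem) e mci_repr_pi. Qed.

Lemma mem_degspaceP P p :
  reflect (forall m, (forall i, m i <= d i)%N -> ~~ P (mdeg m) -> p@_m = 0)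
          (mci_pi p \in degspace P).
Proof.
apply: (iffP idP) => [Pp m lem nPm | p0]; last first.
  rewrite mci_pi_expand rpred_sum // => t _.
  have [Pt|nPt] := boolP (P (mci_deg t)); last first.
    by rewrite (p0 _ (mci_mnm_le t) nPt) scale0r rpred0.
  by rewrite rpredZ // memv_span // image_f.
(* Coefficients in the box depend only on the class, so [p] may be traded for a representative
   supported in the degrees of [P]. *)
have [q e q0] : exists2 q, mci_pi p = mci_pi q :> mci F d &
    forall m, ~~ P (mdeg m) -> q@_m = 0; last first.
  by rewrite (mci_pi_coef e lem) q0.
move: Pp; rewrite /degspace; set X := image _ _.
move=> /(@coord_span _ _ _ (in_tuple X)) ->.
elim/big_ind: _ => [|_ _ [u -> u0] [v -> v0]|k _].
- by exists 0; rewrite ?raddf0 // => k _; rewrite mcoeff0.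
- by exists (u + v); rewrite ?raddfD // => k nPk; rewrite mcoeffD u0 ?v0 ?addr0.
- have /imageP[t] : X`_k \in X by rewrite mem_nth.
  rewrite inE => Pt ->.
  exists (coord (in_tuple X) k (mci_pi p) *: 'X_[mci_mnm t]).
    by rewrite linearZ.
  move=> k' nPk; rewrite mcoeffZ mcoeffX.
  case: eqP => [e|]; last by rewrite mulr0.
  by rewrite -e Pt in nPk.
Qed.

(** The monomials in the box span B and number dim B, so they are free; a permutation puts those
    selected by [P] in front. *)
Lemma dim_degspace P : \dim (degspace P) = count_deg P.
Proof.
set s := enum {: mci_index d}.
have fullX : free [seq mci_mon t | t <- s].
  apply: (@basis_free _ _ fullv); rewrite basisEdim size_map -cardE dimvf.
  rewrite leqnn andbT; apply/subvP => b _; rewrite -[b]mci_reprK mci_pi_expand.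
  rewrite rpred_sum // => t _.
  by rewrite rpredZ // memv_span // map_f ?mem_enum.
pose a := [pred t | P (mci_deg t)].
have : free ([seq mci_mon t | t <- s & a t] ++
             [seq mci_mon t | t <- s & ~~ a t]).
  rewrite -map_cat -(@perm_free _ _ [seq mci_mon t | t <- s]) //.
  by apply: perm_map; rewrite perm_sym (perm_filterC a).
move/catl_free; rewrite /free /degspace /image_mem.
have -> : filter a s = enum a by rewrite /s enumT; apply: eq_filter.
by move/eqP => ->; rewrite size_map -cardE.
Qed.

Lemma degspaceT P : (forall k, (k <= N)%N -> P k) -> degspace P = fullv.
Proof.
move=> PT; apply/vspaceP => b; rewrite memvf -[b]mci_reprK.
by apply/mem_degspaceP => m lem; rewrite PT // mdeg_le.
Qed.

Lemma degspaceS P Q : (forall k, (k <= N)%N -> P k -> Q k) ->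
  (degspace P <= degspace Q)%VS.
Proof.
move=> PQ; apply/subvP => b; rewrite -[b]mci_reprK => /mem_degspaceP Pb.
apply/mem_degspaceP => m lem nQ; apply: Pb => //; apply: contra nQ.
by apply: PQ; rewrite mdeg_le.
Qed.

Lemma degspaceU P Q : (degspace P + degspace Q)%VS = degspace (predU P Q).
Proof.
apply/eqP; rewrite eqEsubv subv_add !degspaceS /=.
- apply/span_subvP => _ /imageP[t /orP PQt ->]; case: PQt => Pt.
    by rewrite (subvP (addvSl _ _)) // memv_span // image_f.
  by rewrite (subvP (addvSr _ _)) // memv_span // image_f.
- by move=> k _ Qk /=; rewrite Qk orbT.
- by move=> k _ Pk /=; rewrite Pk.
Qed.

Lemma degspaceI P Q : (forall k, (k <= N)%N -> P k -> ~~ Q k) ->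
  (degspace P :&: degspace Q = 0)%VS.
Proof.
move=> PnQ; apply/eqP; rewrite -subv0; apply/subvP => b.
rewrite memv_cap -[b]mci_reprK => /andP[/mem_degspaceP Pb /mem_degspaceP Qb].
rewrite memv0 mci_pi_expand big1 // => t _.
have [Pt|nPt] := boolP (P (mci_deg t)); last first.
  by rewrite (Pb _ (mci_mnm_le t) nPt) scale0r.
by rewrite (Qb _ (mci_mnm_le t) (PnQ _ (mci_deg_le t) Pt)) scale0r.
Qed.

Lemma degspaceM P Q (R : pred nat) u v :
  (forall x y, P x -> Q y -> R (x + y)%N) ->
  u \in degspace P -> v \in degspace Q -> u * v \in degspace R.
Proof.
move=> PQR; rewrite -[u]mci_reprK -[v]mci_reprK -rmorphM.
move=> /mem_degspaceP Pu /mem_degspaceP Qv; apply/mem_degspaceP => m lem nR.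
rewrite mcoeffM big1 // => -[k1 k2] /= /eqP def_m.
have /mnmP def := def_m.
have le1 i : (k1 i <= d i)%N.
  by apply: leq_trans (lem i); rewrite def mnmDE leq_addr.
have le2 i : (k2 i <= d i)%N.
  by apply: leq_trans (lem i); rewrite def mnmDE leq_addl.
have [P1|] := boolP (P (mdeg k1)); last by move/(Pu _ le1) ->; rewrite mul0r.
rewrite (Qv k2) ?mulr0 //; apply: contra nR => Q2.
by rewrite def_m mdegD PQR.
Qed.

Lemma mci_homogE i : mci_homog F d i = degspace (pred1 i).
Proof.
apply/vspaceP => b; apply/idP/idP => [/mem_mci_homog[p homp ->]|].
  by apply/mem_degspaceP => m _ /= ne; apply: (dhomog_nemf_coeff homp).
apply/subvP/span_subvP => _ /imageP[t /eqP degt ->].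
by apply/mem_mci_homog; exists 'X_[mci_mnm t]; rewrite // dhomogX /= -degt.
Qed.

(** The involution m_i -> d_i - m_i sends degree k to degree N - k. *)
Lemma count_deg_sym k : (k <= N)%N ->
  count_deg (pred1 (N - k)%N) = count_deg (pred1 k).
Proof.
move=> lek; pose rev t : mci_index d := [ffun i => rev_ord (t i)].
have revK : involutive rev.
  by move=> t; apply/ffunP => i; rewrite !ffunE rev_ordK.
have deg_rev t : (mci_deg (rev t) + mci_deg t = N)%N.
  rewrite /mci_deg !mdegE -big_split; apply: eq_bigr => i _ /=.
  by rewrite !mnmE ffunE /= subSS subnK // -ltnS.
rewrite /count_deg -!sum1_card (reindex_inj (inv_inj revK)).
by apply: eq_bigl => t; rewrite !inE; have := deg_rev t; lia.
Qed.

Lemma count_degU P Q : (forall k, (k <= N)%N -> P k -> ~~ Q k) ->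
  (count_deg P + count_deg Q = count_deg (predU P Q))%N.
Proof.
move=> PnQ; rewrite /count_deg -cardUI [X in (_ + X)%N]eq_card0 ?addn0.
  by apply: eq_card => t; rewrite !inE.
move=> t; rewrite !inE; apply/andP => -[Pt].
exact/negP/(PnQ _ (mci_deg_le t) Pt).
Qed.

Lemma count_degE P :
  count_deg P = (\sum_(k < N.+1 | P k) count_deg (pred1 (k : nat)))%N.
Proof.
(* Degrees are at most N, so [inord] never falls back on its default. *)
pose deg t : 'I_N.+1 := inord (mci_deg t).
rewrite /count_deg -sum1_card (partition_big deg (fun k => P k)) /=; last first.
  by move=> t; rewrite /deg inE inordK // ltnS mci_deg_le.
apply: eq_bigr => k Pk; rewrite -sum1_card; apply: eq_bigl => t; rewrite !inE.
have lt : (mci_deg t < N.+1)%N by rewrite ltnS mci_deg_le.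
by rewrite /deg -val_eqE /= inordK //; case: eqP => [->|]; rewrite ?Pk ?andbF.
Qed.

End DegreeSubspaces.

(** * The strong Lefschetz property *)

Lemma mcoeff_pihomog (R : nzRingType) n e (p : {mpoly R[n]}) m :
  (pihomog mdeg e p)@_m = if mdeg m == e then p@_m else 0.
Proof.
rewrite pihomogE [p in RHS]mpolyE !raddf_sum /= big_mkcond /=.
case: ifP => [/eqP <-|ne]; last first.
  rewrite big1 // => k _; case: ifP => // degk; rewrite mcoeffZ mcoeffX.
  case: eqP => [e_k|_]; last by rewrite mulr0.
  by rewrite -e_k degk in ne.
apply: eq_bigr => k _; rewrite mcoeffZ mcoeffX.
by case: (eqVneq k m) => [->|_]; rewrite ?eqxx //= mulr0 if_same.
Qed.

Section StrongLefschetz.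
Variables (F : fieldType) (n : nat) (d : 'I_n -> nat).
Implicit Types (p q : {mpoly F[n]}) (m : 'X_{1..n}) (P Q : pred nat).
Let N := (\sum_(i < n) d i)%N.
Hypothesis charF : forall p : nat, p \in [pchar F] -> (N < p)%N.
Let s : mci F d := mci_pi mpoly_sumX.
Local Notation h i := (count_deg d (pred1 i)).
Local Notation W P := (degspace F d P).

(** The part of s^k p in degree k + e is s^k times the part of p in degree e, and a monomial ideal
    contains the homogeneous parts of its members. *)
Lemma pihomog_ideal p e k : mpoly_sumX ^+ k * p \in mci_ideal d ->
  mpoly_sumX ^+ k * pihomog mdeg e p \in mci_ideal d.
Proof.
have homX : (@mpoly_sumX F n) ^+ k \is k.-homog.
  by rewrite -[X in X.-homog]mul1n; apply/dhomogMn/dhomog_mpoly_sumX.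
move=> /mci_ideal_coefP Ip; apply/mci_ideal_coefP => m lem.
have [degm|ne] := eqVneq (mdeg m) (k + e)%N; last first.
  by apply: dhomog_nemf_coeff ne; apply: (dhomogM homX (pihomogP _ _ _)).
rewrite -[RHS](Ip m lem) !mcoeffM; apply: eq_bigr => -[k1 k2] /= /eqP def_m.
have [deg1|ne] := eqVneq (mdeg k1) k; last first.
  by rewrite (dhomog_nemf_coeff homX ne) !mul0r.
rewrite mcoeff_pihomog; case: eqP => // ne; case: ne.
move/(congr1 (@mdeg n)): def_m => /(etrans (esym degm)).
by rewrite mdegD deg1 => /addnI.
Qed.

(** The kernel of s^k is graded, so [raising_inj] applies to each homogeneous part. *)
Lemma sumX_pow_inj a k : (forall e, (e < a)%N -> (e.*2 + k <= N)%N) ->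
  (W [pred e | e < a]%N :&: lker (amull (s ^+ k)%R) = 0)%VS.
Proof.
move=> le_N; apply/eqP; rewrite -subv0; apply/subvP => b.
rewrite memv_cap memv_ker lfunE /= memv0 -[b]mci_reprK.
set p := mci_repr b => /andP[/mem_degspaceP Pp].
rewrite /s -rmorphXn -rmorphM /= !mci_pi_eq0 => Ip.
apply/mci_ideal_coefP => m lem.
have [lta|gea] := ltnP (mdeg m) a; last by rewrite Pp //= -leqNgt.
have /mci_ideal_coefP/(_ m lem) := raising_inj charF (pihomogP _ _ _)
  (le_N _ lta) (pihomog_ideal (mdeg m) Ip).
by rewrite mcoeff_pihomog eqxx.
Qed.

Lemma sumX_pow_deg k : s ^+ k \in W (pred1 k).
Proof.
rewrite -mci_homogE; apply/mem_mci_homog.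
exists (mpoly_sumX ^+ k); last exact/esym/rmorphXn.
by rewrite -[X in X.-homog]mul1n; apply/dhomogMn/dhomog_mpoly_sumX.
Qed.

Lemma sumX_pow_inj1 e k : (e.*2 + k <= N)%N ->
  (W (pred1 e) :&: lker (amull (s ^+ k)%R) = 0)%VS.
Proof.
move=> le_N; apply/eqP; rewrite -subv0 -(@sumX_pow_inj e.+1 k).
  by rewrite capvS // degspaceS // => i _ /eqP ->; rewrite /= ltnS.
by move=> i; lia.
Qed.

Lemma limg_sumX_pow_sub e k :
  (amull (s ^+ k)%R @: W (pred1 e) <= W (pred1 (e + k)%N))%VS.
Proof.
apply/subvP => _ /memv_imgP[v Wv ->]; rewrite lfunE /=.
apply: degspaceM (sumX_pow_deg k) Wv => a b /= /eqP -> /eqP ->.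
by rewrite addnC.
Qed.

(** The power s^(f-e) embeds B_e into B_f, because 2e + (f - e) = e + f. *)
Lemma hilbert_homo e f : (e <= f)%N -> (e + f <= N)%N -> (h e <= h f)%N.
Proof.
move=> lef leN; rewrite -!(dim_degspace F) -(subnKC lef).
rewrite -(limg_dim_eq (@sumX_pow_inj1 e (f - e) _)).
  exact/dimvS/limg_sumX_pow_sub.
by rewrite -addnn; lia.
Qed.

Lemma hilbert_gt0 e : (e <= N)%N -> (0 < h e)%N.
Proof.
move=> leN; apply: (@leq_trans (h 0%N)); last by apply: hilbert_homo.
rewrite -(dim_degspace F) lt0n dimv_eq0; apply/eqP => W0.
have : 1 \in W (pred1 0%N) by rewrite -[1]/(s ^+ 0) sumX_pow_deg.
by rewrite W0 memv0 oner_eq0.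
Qed.

(** For i >= e + k, s^(2i-N) maps B_(N-i) injectively into B_i, and onto it since the dimensions
    agree. As 2i - N >= k, this power factors through s^k. *)
Lemma sumX_pow_surj e k : (N <= e.*2 + k)%N ->
  (W [pred i | e + k <= i]%N <= limg (amull (s ^+ k)%R))%VS.
Proof.
move=> leN; apply/span_subvP => _ /imageP[t /= lei ->].
rewrite inE /= in lei; have := mci_deg_le t; rewrite -/N.
set i := mci_deg t in lei * => leiN.
have e2 : ((N - i).*2 + (i.*2 - N) = N)%N by lia.
have le2 : ((N - i).*2 + (i.*2 - N) <= N)%N by rewrite e2.
have defW : (amull (s ^+ (i.*2 - N))%R @: W (pred1 (N - i)%N) = W (pred1 i))%VS.
  apply/eqP; rewrite eqEdim (limg_dim_eq (sumX_pow_inj1 le2)).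
  rewrite !dim_degspace count_deg_sym // leqnn andbT.
  apply: subv_trans (limg_sumX_pow_sub _ _) _.
  by apply: degspaceS => l _ /eqP ->; apply/eqP; lia.
have : mci_mon F t \in W (pred1 i).
  by apply/memv_span/image_f; rewrite inE /= eqxx.
rewrite -defW => /memv_imgP[w _ ->].
have -> : (i.*2 - N = k + (i.*2 - N - k))%N by lia.
by rewrite exprD amullM lfunE memv_img ?memvf.
Qed.

(* The degrees outside a window of k consecutive ones; for a = (N.+1 - k)./2 the
   window is central in [0, N]. *)
Definition outer a k : pred nat := [pred e | (e < a) || (a + k <= e)]%N.

Lemma count_outer a k : count_deg d (outer a k) =
  (count_deg d [pred e | e < a] + count_deg d [pred e | a + k <= e])%N.
Proof. by rewrite count_degU // => e _ /=; lia. Qed.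

Lemma rank_mul_le a k f : f \in W [pred e | k <= e]%N ->
  (\dim (limg (amull f)) <= count_deg d (outer a k))%N.
Proof.
move=> Wf; rewrite count_outer -!(dim_degspace F).
rewrite -(@degspaceT _ _ _
  (predU [pred e | e < a] [pred e | a <= e])%N); last first.
  by move=> e _ /=; lia.
rewrite -degspaceU limgD (leq_trans (dimv_add_leqif _ _)) // leq_add //.
  by rewrite -(limg_ker_dim (amull f) (W [pred e | e < a]%N)) leq_addl.
apply: dimvS; apply/subvP => _ /memv_imgP[v Wv ->]; rewrite lfunE /=.
by apply: degspaceM Wf Wv => x y /=; lia.
Qed.

(** For this [a], e < a gives 2e + k <= N, and N <= 2a + k. So s^k is injective below degree a and
    reaches every degree from a + k on; the image of the low part stays below a + k, so the two
    dimensions add. *)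
Lemma rank_sumX_pow_ge k a : (k <= N.+1)%N -> a = (N.+1 - k)./2 ->
  (count_deg d (outer a k) <= \dim (limg (amull (s ^+ k)%R)))%N.
Proof.
move=> lek def_a; rewrite count_outer -!(dim_degspace F).
have le_a e : (e < a)%N -> (e.*2 + k <= N)%N by lia.
rewrite -(limg_dim_eq (sumX_pow_inj le_a)).
rewrite -dimv_disjoint_sum; last first.
  apply/eqP; rewrite -subv0.
  rewrite -(@degspaceI F n d [pred e | e < a + k]
    [pred e | a + k <= e])%N; last first.
    by move=> e _ /=; lia.
  rewrite capvS //; apply/subvP => _ /memv_imgP[v Wv ->]; rewrite lfunE /=.
  by apply: degspaceM (sumX_pow_deg k) Wv => x y /=; lia.
by apply: dimvS; rewrite subv_add limgS ?subvf // sumX_pow_surj //; lia.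
Qed.

End StrongLefschetz.

(** * Weyr structure *)

Lemma shift_rank_amull (F : fieldType) (A : falgType F) (u : A) a k :
  shift_rank (amull u) a k = \dim (limg (amull ((u - a *: 1) ^+ k))).
Proof.
rewrite /shift_rank -amull1 -linearZ -linearB; congr (\dim (limg _)).
elim: k => [|k IHk]; first by rewrite expr0 amull1.
rewrite /lfun_pow iterS -/(lfun_pow _ k) IHk; apply/lfunP => x.
by rewrite comp_lfunE !lfunE /= exprS mulrA.
Qed.

Section ConstantTerm.
Variables (F : fieldType) (n : nat) (d : 'I_n -> nat).

(** Removing the constant term is linear in [b], which is what makes the entries of the powers
    polynomial in [b]. *)
Definition mci_reduced (b : mci F d) : mci F d := b - mci_const b *: 1.

Fact mci_reduced_linear : linear mci_reduced.
Proof.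
move=> c u v; rewrite /mci_reduced -[u]mci_reprK -[v]mci_reprK -linearP.
rewrite !mci_const_pi mcoeffD mcoeffZ linearP scalerDl -scalerA scalerBr.
by rewrite opprD addrACA.
Qed.

HB.instance Definition _ :=
  GRing.isLinear.Build F (mci F d) (mci F d) *:%R mci_reduced
    mci_reduced_linear.

Lemma mci_reduced_power_deg b k :
  mci_reduced b ^+ k \in degspace F d [pred e | k <= e]%N.
Proof.
rewrite /mci_reduced -[b]mci_reprK -(rmorph1 mci_pi) -linearZ -raddfB -rmorphXn.
set p := mci_repr b; rewrite mci_const_pi.
apply/mem_degspaceP => m _ /=; rewrite -ltnNge => ltk.
apply: mcoeff_expr_eq0 ltk.
by rewrite mcoeffB mcoeffZ mcoeff1 eqxx mulr1 subrr.
Qed.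

Lemma mci_reduced_sumX : mci_reduced (mci_pi mpoly_sumX) = mci_pi mpoly_sumX.
Proof.
rewrite /mci_reduced mci_const_pi (dhomog_nemf_coeff (dhomog_mpoly_sumX F n)).
  by rewrite scale0r subr0.
by rewrite /= mdeg0.
Qed.

End ConstantTerm.

(** * Listing the Hilbert function from the centre outwards *)

Section CentralOrder.
Variables (F : fieldType) (n : nat) (d : 'I_n -> nat).
Let N := (\sum_(i < n) d i)%N.
Hypothesis charF : forall p : nat, p \in [pchar F] -> (N < p)%N.
Local Notation h i := (count_deg d (pred1 i)).
Local Notation R k := (count_deg d (outer ((N.+1 - k)./2) k)).

(** With m = floor((N-k)/2), the central window gains degree m on its left if N - k is odd, and
    degree m + k = N - m on its right if N - k is even; symmetry gives h_m in both cases. *)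
Lemma count_outerS k : (k <= N)%N -> R k = (R k.+1 + h ((N - k)./2))%N.
Proof.
move=> lek; have [Ek|Ek] := boolP (odd (N - k)).
  rewrite count_degU; last by move=> e _; rewrite /outer /=; lia.
  rewrite /count_deg; apply: eq_card => t; rewrite !inE; have := mci_deg_le t.
  by rewrite -/N /outer /=; lia.
have le2 : ((N - k)./2 <= N)%N by lia.
have sym2 : h (N - (N - k)./2)%N = h ((N - k)./2) := count_deg_sym le2.
rewrite -sym2 count_degU; last by move=> e _; rewrite /outer /=; lia.
rewrite /count_deg; apply: eq_card => t; rewrite !inE; have := mci_deg_le t.
by rewrite -/N /outer /=; lia.
Qed.

Lemma count_outer_last : R N.+1 = 0%N.
Proof.
rewrite subnn /count_deg; apply: eq_card0 => t; rewrite !inE /outer /=.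
by rewrite add0n leqNgt ltnS mci_deg_le.
Qed.

Lemma sort_hilbert :
  sort geq [seq h i | i <- iota 0 N.+1] =
  [seq h ((N - i)./2) | i <- iota 0 N.+1].
Proof.
apply: (@sorted_eq _ geq) => [y x z /= lexy leyz||||].
- exact: leq_trans leyz lexy.
- by move=> x y; rewrite /= andbC => /anti_leq.
- by apply: sort_sorted => x y; rewrite /= leq_total.
- apply: (homo_sorted_in (P := [pred i | i <= N]%N) (e := ltn)).
  + move=> i j; rewrite !inE => lei lej ltij /=.
    by apply: (hilbert_homo charF); lia.
  + by apply/allP => i; rewrite mem_iota inE; lia.
  + exact: iota_ltn_sorted.
rewrite perm_sort.
(* By induction on k, the k central degrees give the first k terms of the right-hand list; k = N + 1
   is the whole range. *)
suff perm_h k : (k <= N.+1)%N ->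
    perm_eq [seq h i | i <- iota ((N.+1 - k)./2) k]
            [seq h ((N - i)./2) | i <- iota 0 k].
  by have := perm_h _ (leqnn _); rewrite subnn.
elim: k => // k IHk ltk; have {IHk} := IHk (ltnW ltk).
have iotaS a : iota a k.+1 = rcons (iota a k) (a + k)%N.
  by rewrite -addn1 iotaD cats1.
rewrite (iotaS 0%N) map_rcons add0n perm_sym => IHk.
rewrite perm_sym perm_rcons; set m := ((N - k)./2) in IHk *.
have [Ek|Ek] := boolP (odd (N - k)).
  have em : ((N.+1 - k)./2 = m.+1)%N by lia.
  by rewrite /= perm_cons -em.
have em : ((N.+1 - k)./2 = m)%N by lia.
rewrite em in IHk; rewrite iotaS map_rcons perm_sym perm_rcons.
have le2 : (m <= N)%N by lia.
have sym2 : h (N - m)%N = h m := count_deg_sym le2.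
have -> : (m + k = N - m)%N by lia.
by rewrite sym2 perm_cons perm_sym.
Qed.

End CentralOrder.

Theorem theorem6p7 (F : closedFieldType) (n : nat) (d : 'I_n -> nat) :
  let N := (\sum_(i < n) d i)%N in
  (forall p : nat, p \in [pchar F] -> (N < p)%N) ->
  \dim {: mci F d} = (\sum_(i < N.+1) \dim (mci_homog F d i))%N
  /\ for_general (fun l : mci F d =>
       weyr_structure (amull l) (mci_const l)
       = sort geq [seq \dim (mci_homog F d i) | i <- iota 0 N.+1]).
Proof.
move=> N charF; split.
  rewrite -(@degspaceT F n d predT) // dim_degspace count_degE.
  by apply: eq_bigr => i _; rewrite mci_homogE dim_degspace.
(* Exponents 0 to N + 1 suffice, since the rank is 0 at N + 1. *)
pose T (k : 'I_N.+2) (v : mci F d) := amull (mci_reduced v ^+ k).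
have [U [openU U_sumX geU]] := @zariski_open_rank _ _ _ N.+2 T
  (mci_pi mpoly_sumX) (fun k => polyfun_mx_power (@mci_reduced F n d) k).
exists U; split=> //; first by exists (mci_pi mpoly_sumX).
move=> l Ul; set c := mci_const l.
(* The upper bound holds for every l; the lower one comes from s by semicontinuity on [U]. *)
have rankE k : (k <= N.+1)%N ->
    shift_rank (amull l) c k = count_deg d (outer ((N.+1 - k)./2) k).
  move=> lek; apply/eqP; rewrite shift_rank_amull -/(mci_reduced l).
  rewrite eqn_leq rank_mul_le ?mci_reduced_power_deg //=.
  rewrite (leq_trans (rank_sumX_pow_ge charF lek erefl)) //.
  have := geU l Ul (Ordinal (lek : (k < N.+2)%N)).
  by rewrite /T /= mci_reduced_sumX.
have rankS k : (k <= N)%N -> shift_rank (amull l) c k =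
    (shift_rank (amull l) c k.+1 + count_deg d (pred1 ((N - k)./2)))%N.
  move=> lek; rewrite (rankE k (leqW lek)).
  rewrite (rankE k.+1 lek).
  exact: count_outerS.
have rank0 : shift_rank (amull l) c N.+1 = 0%N.
  by rewrite (rankE _ (leqnn _)) count_outer_last.
have -> : [seq \dim (mci_homog F d i) | i <- iota 0 N.+1] =
    [seq count_deg d (pred1 i) | i <- iota 0 N.+1].
  by apply: eq_map => i; rewrite mci_homogE dim_degspace.
rewrite (sort_hilbert charF) /weyr_structure.
(* Ranks vanish from N + 1 on, while at each r <= N they drop by some h_i > 0. *)
have -> : weyr_index (amull l) c = N.+1.
  rewrite /weyr_index; case: ex_minnP => r /andP[r_gt0 /eqP eq_r] min_r.
  apply/eqP; rewrite eqn_leq min_r ?rank0 /=; last first.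
    by have := shift_rankS (amull l) c N.+1; rewrite rank0 leqn0 eq_sym.
  rewrite ltnNge; apply/negP => ler; move/eqP: eq_r.
  rewrite (rankS r ler) -[X in _ == X]addn0 eqn_add2l => /eqP h0.
  suff : (0 < count_deg d (pred1 ((N - r)./2)))%N by rewrite h0.
  by apply: (hilbert_gt0 charF); rewrite -/N; lia.
apply/eq_in_map => i; rewrite mem_iota ltnS => /andP[_ lei].
by rewrite (rankS i lei) addKn.
Qed.
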